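(* For every $k\ge2$ there exist a differential safety property $\varphi$ of order $k$ and a differential safety game $\mathfrak G_\varphi=(\mathcal S,\mathcal A,\mathsf T,\mathcal F_\varphi,s_{\mathrm{init}})$ such that $\mathfrak G_\varphi$ has a $k$-history dependent winning strategy but no $(k-1)$-history dependent winning strategy.
   Context: **Sequences.** $\mathbb N=\{0,1,2,\dots\}$. For a set $\mathcal S$, $\mathcal S^*$ and $\mathcal S^\omega$ are the finite and infinite sequences over $\mathcal S$, and $\mathcal S^\infty=\mathcal S^*\cup\mathcal S^\omega$. For $w=s_1s_2\cdots$, $|w|\in\mathbb N\cup\{\infty\}$ is its length and $w_{1:t}=s_1\cdots s_t$. **Discrete derivatives.** $\mathcal S\subseteq\mathbb R^d$ is finite and $\Delta\tau>0$ is a fixed time step. For $w=s_1s_2\cdots\in\mathcal S^\infty$, $\partial^0_t(w)=s_t$ and $\partial^k_t(w)=(\partial^{k-1}_t(w)-\partial^{k-1}_{t-1}(w))/\Delta\tau$, for $k<t\le|w|$. **Differential safety properties.** These are the formulas $\varphi::=(\partial^k\in\mathcal R)\mid\varphi\land\varphi\mid\lnot\varphi$ with $k\in\mathbb N$, $\mathcal R\subseteq\mathbb R^d$. The order $\mathrm{ord}(\varphi)$ is the largest $k$ occurring in an atom $(\partial^k\in\mathcal R)$ of $\varphi$. For $\mathrm{ord}(\varphi)+1\le t\le|w|$, the local value $[\![\varphi]\!]_t(w)\in\{\top,\bot\}$ is defined by: $[\![\partial^j\in\mathcal R]\!]_t(w)=\top$ iff $\partial^j_t(w)\in\mathcal R$,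 extended to Boolean connectives as usual. Globally, for $\mathrm{ord}(\varphi)=k$, $w\models\varphi$ iff $[\![\varphi]\!]_t(w)=\top$ for all $t$ with $k+1\le t\le|w|$. **Games.** A differential safety game is $\mathfrak G_\varphi=(\mathcal S,\mathcal A,\mathsf T,\mathcal F_\varphi,s_{\mathrm{init}})$ with finite state set $\mathcal S\subseteq\mathbb R^d$, finite nonempty action set $\mathcal A$, transition relation $\mathsf T\colon\mathcal S\times\mathcal A\to2^{\mathcal S}$ with all values nonempty, winning condition $\mathcal F_\varphi=\{w\in\mathcal S^\omega: w\models\varphi\}$, and $s_{\mathrm{init}}\in\mathcal S$. Write $s\xrightarrow{a}s'$ if $s'\in\mathsf T(s,a)$, and $s\to s'$ if this holds for some $a$. A path is $w=s_1s_2\cdots\in\mathcal S^\omega$ with $s_t\to s_{t+1}$ for all $t$; it is winning if $w\in\mathcal F_\varphi$. **Strategies.** A strategy is a map $\xi\colon\mathcal S^*\to2^{\mathcal A}$. A sequence $w=s_1s_2\cdots\in\mathcal S^\infty$ is consistent with $\xi$ if for every $t<|w|$ there is $a\in\xi(w_{1:t})$ with $s_t\xrightarrow{a}s_{t+1}$. $\xi$ is winning if $\xi(w)\ne\emptyset$ for every finite nonempty $w$ starting in $s_{\mathrm{init}}$ and consistent with $\xi$, and every path starting in $s_{\mathrm{init}}$ and consistent with $\xi$ is winning. $\xi$ is $k$-history dependent if $\xi(w)$ depends only on the last $\min\{|w|,k\}$ states of $w$. *)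

(* Defs.v *)
From HB Require Import structures.
From mathcomp Require Import all_boot all_order all_algebra.
From mathcomp Require Import finmap.
From mathcomp Require Import boolp classical_sets reals.

Set Implicit Arguments.
Unset Strict Implicit.
Unset Printing Implicit Defensive.

Import Order.TTheory GRing.Theory Num.Theory.
Local Open Scope ring_scope.

(* Finite and infinite sequences over T. Positions are numbered from 1: the
   word s_1 s_2 ... has s_t at position t, hence the shifts below. *)
Inductive word (T : Type) : Type :=
  | Fin of seq T
  | Inf of (nat -> T).

(* Some s_t if 1 <= t <= |w|, and None otherwise. *)
Definition letter (T : Type) (w : word T) (t : nat) : option T :=
  if t is t'.+1 then
    match w with
    | Fin s => onth s t'
    | Inf f => Some (f t')
    end
  else None.

(* t <= |w|, where |w| may be infinite. *)
Definition le_length (T : Type) (t : nat) (w : word T) : bool :=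
  match w with
  | Fin s => (t <= size s)%N
  | Inf _ => true
  end.

(* w_{1:t}, for t <= |w|. *)
Definition wprefix (T : Type) (w : word T) (t : nat) : seq T :=
  match w with
  | Fin s => take t s
  | Inf f => mkseq f t
  end.

(* The value is meaningful only for k < t <= |w|; outside this range absent
   letters are read as 0. *)
Fixpoint dderiv (R : realType) (d : nat) (S : {fset 'rV[R]_d}) (dtau : R)
    (k t : nat) (w : word S) : 'rV[R]_d :=
  if k is k'.+1 then
    dtau^-1 *: (dderiv dtau k' t w - dderiv dtau k' t.-1 w)
  else oapp val 0 (letter w t).

Inductive formula (R : realType) (d : nat) : Type :=
  | Atom of nat & set 'rV[R]_d
  | And of formula R d & formula R d
  | Not of formula R d.

Fixpoint ord (R : realType) (d : nat) (phi : formula R d) : nat :=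
  match phi with
  | Atom k _ => k
  | And phi1 phi2 => maxn (ord phi1) (ord phi2)
  | Not phi1 => ord phi1
  end.

(* Meaningful only for ord phi + 1 <= t <= |w|. *)
Fixpoint local_value (R : realType) (d : nat) (S : {fset 'rV[R]_d}) (dtau : R)
    (phi : formula R d) (t : nat) (w : word S) : bool :=
  match phi with
  | Atom j A => dderiv dtau j t w \in A
  | And phi1 phi2 => local_value dtau phi1 t w && local_value dtau phi2 t w
  | Not phi1 => ~~ local_value dtau phi1 t w
  end.

Definition models (R : realType) (d : nat) (S : {fset 'rV[R]_d}) (dtau : R)
    (w : word S) (phi : formula R d) : Prop :=
  forall t : nat,
    ((ord phi).+1 <= t)%N -> le_length t w -> local_value dtau phi t w.

(* The winning condition of a game is determined by its states and by the
   parameters dtau and phi; it is [win_cond] below. *)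
Record game (R : realType) (d : nat) (dtau : R) (phi : formula R d) := Game {
  states : {fset 'rV[R]_d};
  action : finType;
  trans : states -> action -> {set states};
  init : states;
  action_neq0 : (0 < #|action|)%N;
  trans_neq0 : forall s a, trans s a != finset.set0
}.

Definition win_cond (R : realType) (d : nat) (dtau : R) (phi : formula R d)
    (G : game dtau phi) : set (nat -> states G) :=
  fun w => models dtau (Inf w) phi.

Definition step (R : realType) (d : nat) (dtau : R) (phi : formula R d)
    (G : game dtau phi) (s s' : states G) : Prop :=
  exists a : action G, s' \in trans s a.

Definition is_path (R : realType) (d : nat) (dtau : R) (phi : formula R d)
    (G : game dtau phi) (w : word (states G)) : Prop :=
  forall (t : nat) (s s' : states G),
    letter w t = Some s -> letter w t.+1 = Some s' -> step s s'.

Definition starts_in_init (R : realType) (d : nat) (dtau : R)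
    (phi : formula R d) (G : game dtau phi) (w : word (states G)) : Prop :=
  letter w 1 = Some (init G).

Definition strategy (R : realType) (d : nat) (dtau : R) (phi : formula R d)
    (G : game dtau phi) : Type :=
  seq (states G) -> {set action G}.

Definition consistent (R : realType) (d : nat) (dtau : R) (phi : formula R d)
    (G : game dtau phi) (xi : strategy G) (w : word (states G)) : Prop :=
  forall (t : nat) (s s' : states G),
    letter w t = Some s -> letter w t.+1 = Some s' ->
    exists2 a : action G, a \in xi (wprefix w t) & s' \in trans s a.

(* Only infinite paths can belong to [win_cond], so the second clause ranges
   over infinite paths. *)
Definition winning (R : realType) (d : nat) (dtau : R) (phi : formula R d)
    (G : game dtau phi) (xi : strategy G) : Prop :=
  (forall w : seq (states G),
      starts_in_init (Fin w) -> consistent xi (Fin w) ->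
      xi w != finset.set0) /\
  (forall w : nat -> states G,
      is_path (Inf w) -> starts_in_init (Inf w) -> consistent xi (Inf w) ->
      win_cond w).

(* The last min(|w|, k) entries of w. *)
Definition last_entries (T : Type) (k : nat) (w : seq T) : seq T :=
  drop (size w - k) w.

Definition history_dependent (R : realType) (d : nat) (dtau : R)
    (phi : formula R d) (G : game dtau phi) (k : nat) (xi : strategy G) :
    Prop :=
  forall w w' : seq (states G),
    last_entries k w = last_entries k w' -> xi w = xi w'.

(* Main.v *)
(* The environment first moves from [init] to a state [x_b], where [b] is a bit
   of its choice; then k-1 forced states follow; then the player moves to a
   state [y_b'], where [b'] is a bit of its choice; then the play enters a sink.
   The property asks for [b = b'].  The k-th derivative at [y_b'] sees exactly
   the window from [x_b] to [y_b'], and [x_b] enters it with coefficient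
   (-1)^k, so this property has order k.  When [b'] is chosen, [x_b] is the k-th
   last state: k states of history reveal [b], but k-1 states do not. *)
Require Import Defs.
From HB Require Import structures.
From mathcomp Require Import all_boot all_order all_algebra.
From mathcomp Require Import finmap.
From mathcomp Require Import boolp classical_sets reals.
From mathcomp Require Import zify.

Import Order.TTheory GRing.Theory Num.Theory.
Local Open Scope ring_scope.

(** * Dependence of the [k]-th derivative on its window *)

Section Derivatives.
Context {R : realType} {d : nat} {S : {fset 'rV[R]_d}} (dtau : R).
Implicit Types w : word S.

Lemma eq_dderiv k t w w' :
  (forall j, (t - k <= j <= t)%N -> letter w j = letter w' j) ->
  dderiv dtau k t w = dderiv dtau k t w'.
Proof.
elim: k t => [|k IHk] t eq_w /=; first by rewrite eq_w //; lia.
by rewrite !IHk // => j hj; apply: eq_w; lia.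
Qed.

(** The recursion reaches the oldest letter of the window only through its subtracted term, so each
    order contributes one factor [- dtau^-1]. *)
Lemma dderiv_sub_oldest k t w w' :
  (forall j, (t - k < j <= t)%N -> letter w j = letter w' j) ->
  (k < t)%N ->
  dderiv dtau k t w - dderiv dtau k t w' =
    (- dtau^-1) ^+ k *:
      (oapp val 0 (letter w (t - k)) - oapp val 0 (letter w' (t - k))).
Proof.
elim: k t => [|k IHk] t eq_w lt_kt; first by rewrite subn0 scale1r.
have tE : (t - k.+1 = t.-1 - k)%N by lia.
rewrite /= (eq_dderiv k t w w'); last by move=> j hj; apply: eq_w; lia.
rewrite -scalerBr opprB addrC addrA subrK -opprB IHk; first last.
- by lia.
- by move=> j hj; apply: eq_w; lia.
by rewrite -tE exprS -scalerA scalerN scaleNr.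
Qed.

End Derivatives.

(** * Consistency of words, with letters indexed from 0 *)

Section ConsistentPrefixes.
Context {R : realType} {d : nat} {dtau : R} {phi : formula R d}.
Context {G : game dtau phi} (xi : strategy G).

Lemma onth_mkseq (T : Type) (f : nat -> T) n i :
  onth (mkseq f n) i = if (i < n)%N then Some (f i) else None.
Proof.
case: ltnP => hi; last by rewrite onth_default ?size_mkseq.
by rewrite onthE -map_comp (nth_map 0%N) ?size_iota // nth_iota.
Qed.

Lemma take_mkseq (T : Type) (f : nat -> T) n i :
  (i <= n)%N -> take i (mkseq f n) = mkseq f i.
Proof.
by move=> le_in; rewrite /mkseq -map_take take_iota (minn_idPl le_in).
Qed.

Lemma consistent_mkseqP (f : nat -> states G) n :
  consistent xi (Fin (mkseq f n.+1)) <->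
  forall t, (t < n)%N ->
    exists2 a, a \in xi (mkseq f t.+1) & f t.+1 \in trans (f t) a.
Proof.
split=> [con_f t lt_tn|step_f [//|t] s s'].
  rewrite -(take_mkseq _ f n.+1); last by lia.
  by apply: (con_f t.+1); rewrite /letter onth_mkseq ifT //; lia.
rewrite /letter /wprefix !onth_mkseq.
case: ltnP => // lt_t [<-]; case: ltnP => // lt_t' [<-].
by rewrite take_mkseq; [apply: step_f|lia].
Qed.

Lemma consistent_infP (f : nat -> states G) :
  consistent xi (Inf f) <->
  forall t, exists2 a, a \in xi (mkseq f t.+1) & f t.+1 \in trans (f t) a.
Proof.
split=> [con_f t|step_f [//|t] s s' [<-] [<-]]; last exact: step_f.
exact: (con_f t.+1).
Qed.

(** Each step may assume that the word so far is consistent, which is what nonemptiness of a winning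
    strategy requires. *)
Lemma consistent_mkseq (f : nat -> states G) n :
  (forall t, (t < n)%N -> consistent xi (Fin (mkseq f t.+1)) ->
     exists2 a, a \in xi (mkseq f t.+1) & f t.+1 \in trans (f t) a) ->
  consistent xi (Fin (mkseq f n.+1)).
Proof.
elim: n => [_|n IHn step_f]; first by apply/consistent_mkseqP.
have con_n : consistent xi (Fin (mkseq f n.+1)).
  by apply: IHn => t lt_tn; apply: step_f; lia.
apply/consistent_mkseqP => t; rewrite ltnS leq_eqVlt => /predU1P[->|lt_tn].
  exact: step_f.
by move/consistent_mkseqP: con_n; apply.
Qed.

End ConsistentPrefixes.

(* The state numbered [n] lies at level [n./2] and carries the bit [odd n].
   Level 0 is the initial state, level 1 holds the [x_b], level [k.+1] the
   [y_b'], and level [k.+2] the sink; odd numbers at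
   the other levels are never reached. *)
Definition edge (k n : nat) (a : bool) (m : nat) : bool :=
  (m./2 == minn n./2.+1 k.+2) &&
  ((n == 0%N) || (odd m == ((n./2 == k) && a))).

(** The invariant of plays at index [i], which is position [i.+1] of the word. Away from the levels
    of [x_b] and [y_b'], the index determines the state. *)
Definition at_level (k i n : nat) : bool :=
  (n./2 == minn i k.+2) && (odd n ==> (i == 1%N) || (i == k.+1)).

Lemma at_level_edge k i n a m : (0 < k)%N ->
  at_level k i n -> edge k n a m -> at_level k i.+1 m.
Proof. rewrite /at_level /edge; lia. Qed.

Definition play (k : nat) (b b' : bool) (i : nat) : nat :=
  ((minn i k.+2).*2 + ((i == 1) && b) + ((i == k.+1) && b'))%N.

Lemma play_edge k b b' i a : (0 < k)%N -> (i = k -> a = b') ->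
  edge k (play k b b' i) a (play k b b' i.+1).
Proof. rewrite /edge /play; lia. Qed.

(** * The game and its winning condition *)

Section Game.
Context {R : realType} {d : nat} (d_gt0 : (0 < d)%N) (dtau : R) (k : nat).

Definition point (n : nat) : 'rV[R]_d := const_mx n%:R.

Lemma point_inj : injective point.
Proof.
move=> m n /rowP /(_ (Ordinal d_gt0)); rewrite !mxE => /eqP.
by rewrite eqr_nat => /eqP.
Qed.

Definition points : {fset 'rV[R]_d} :=
  seq_fset tt [seq point i | i : 'I_(k.+3.*2)].

Lemma point_in_points (i : 'I_(k.+3.*2)) : point i \in points.
Proof. by rewrite seq_fsetE; apply/fintype.imageP; exists i. Qed.

Definition state (n : nat) : points := [` point_in_points (inord n)]%fset.

Definition number (s : points) : nat :=
  oapp (@nat_of_ord _) 0%N [pick i : 'I_(k.+3.*2) | point i == val s].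

Lemma point_number s : point (number s) = val s.
Proof.
rewrite /number; case: pickP => [i /eqP //|no_i].
have := valP s; rewrite seq_fsetE => /fintype.imageP[i _ si].
by move: (no_i i); rewrite si eqxx.
Qed.

Lemma number_inj : injective number.
Proof. by move=> s s' e; apply: val_inj; rewrite /= -!point_number e. Qed.

Lemma stateK n : (n < k.+3.*2)%N -> number (state n) = n.
Proof. by move=> lt_n; apply: point_inj; rewrite point_number /= inordK. Qed.

Definition is_play (w : nat -> points) : Prop :=
  forall i, at_level k i (number (w i)).

(** Describing the forbidden derivatives through plays with the wrong bit avoids computing
    alternating binomial sums. *)
Definition bad_values (b' : bool) : set 'rV[R]_d :=
  [set x | exists w : nat -> points,
     [/\ is_play w, number (w k.+1) = (k.+1.*2 + b')%N,
         odd (number (w 1%N)) = ~~ b'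
       & x = dderiv dtau k k.+2 (Inf w)]]%classic.

(** The atom of order 0 singles out the visit to [y_b'], so the derivative is unconstrained
    elsewhere. *)
Definition bits_agree (b' : bool) : formula R d :=
  Not (And (Atom 0 [set point (k.+1.*2 + b')%N]%classic)
           (Atom k (bad_values b'))).

Definition phi : formula R d := And (bits_agree false) (bits_agree true).

Lemma ord_phi : ord phi = k.
Proof. by rewrite /= !max0n maxnn. Qed.

Definition next (s : points) (a : bool) : {set points} :=
  [set s' | edge k (number s) a (number s')].

Lemma next_neq0 s a : next s a != finset.set0.
Proof.
pose m := ((minn (number s)./2.+1 k.+2).*2 + (((number s)./2 == k) && a))%N.
apply/set0Pn; exists (state m).
by rewrite inE stateK /edge /m; lia.
Qed.

Lemma bool_gt0 : (0 < #|{: bool}|)%N.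
Proof. by rewrite card_bool. Qed.

Definition delay_game : game dtau phi :=
  @Game R d dtau phi points bool next (state 0) bool_gt0 next_neq0.

Context (dtau_gt0 : 0 < dtau) (k_gt1 : (1 < k)%N).

(** The states strictly between [x_b] and [y_b'] are forced, so only the oldest position of the
    window, position 2, can differ. *)
Lemma eq_window (w w' : nat -> points) :
  is_play w -> is_play w' -> number (w k.+1) = number (w' k.+1) ->
  forall j, (2 < j <= k.+2)%N -> letter (Inf w) j = letter (Inf w') j.
Proof.
move=> pw pw' eq_last [|j] //= hj; congr Some; apply: number_inj.
have [->//|ne_j] := eqVneq j k.+1.
by move: (pw j) (pw' j); rewrite /at_level; lia.
Qed.

Lemma models_phi (w : nat -> points) : is_play w ->
  models dtau (Inf w) phi <->
    odd (number (w 1%N)) = odd (number (w k.+1)).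
Proof.
move=> pw.
have bit_last : number (w k.+1) = (k.+1.*2 + odd (number (w k.+1)))%N.
  by move: (pw k.+1); rewrite /at_level; lia.
split=> [w_phi|agree].
  apply: contrapT => differ.
  have := w_phi k.+2; rewrite ord_phi => /(_ (leqnSn _) isT).
  have : ~~ local_value dtau (bits_agree (odd (number (w k.+1)))) k.+2 (Inf w).
    rewrite /= negbK; apply/andP; split; apply/mem_set => /=.
      by rewrite -bit_last point_number.
    exists w; split=> //.
    by apply/eqP; move/eqP: differ; case: (odd _); case: (odd _).
  by case: (odd _) => /negP not_b /andP[? ?]; apply: not_b.
have phi_b b' t : (k < t)%N -> local_value dtau (bits_agree b') t (Inf w).
  case: t => // t lt_kt /=; apply/negP => /andP[/set_mem /= y_t].
  have {}y_t : number (w t) = (k.+1.*2 + b')%N.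
    by apply: point_inj; rewrite point_number; exact: y_t.
  have tE : t = k.+1 by move: (pw t); rewrite /at_level; lia.
  (* [w'] reaches the same [y_b'] after the opposite bit. The oldest letter has a nonzero
     coefficient, so equal derivatives would force equal [x_b]. *)
  move=> /set_mem [w' [pw' y' x' /esym /eqP]]; rewrite tE -subr_eq0.
  rewrite dderiv_sub_oldest //; first last.
    move=> j hj; apply: eq_window => //; first by rewrite y' -y_t tE.
    by lia.
  have -> : (k.+2 - k = 2)%N by lia.
  rewrite scaler_eq0 expf_eq0 oppr_eq0 invr_eq0 gt_eqF // andbF /= subr_eq0.
  rewrite -!point_number => /eqP/point_inj eq_x.
  by move: agree; rewrite -eq_x x' -tE y_t oddD odd_double oddb; case: (b').
by move=> t; rewrite ord_phi => lt_kt _; apply/andP; split; apply: phi_b.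
Qed.

(** * Strategies with [k] and with [k - 1] states of memory *)

Lemma path_is_play (w : nat -> states delay_game) :
  is_path (Inf w) -> starts_in_init (Inf w) -> is_play w.
Proof.
move=> path_w [w0]; elim=> [|i at_i].
  by rewrite w0 stateK // /at_level; lia.
have [a] := path_w i.+1 _ _ erefl erefl.
by rewrite inE; apply: at_level_edge at_i; lia.
Qed.

Definition recall : strategy delay_game :=
  fun w => [set odd (number (head (state 0) (last_entries k w)))].

Lemma winning_recall : winning recall.
Proof.
split=> [w _ _|w path_w init_w /consistent_infP/(_ k)[a]].
  by apply/set0Pn; eexists; exact: set11.
have play_w := path_is_play _ path_w init_w.
(* The prefix has [k.+1] letters, so its last [k] begin at index 1, with [x_b]. *)
rewrite !inE /last_entries size_mkseq subSnn -nth0 nth_drop.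
rewrite nth_mkseq; last by lia.
move=> /eqP -> step_w; apply/models_phi => //.
by move: (play_w k) step_w; rewrite /at_level /edge; lia.
Qed.

Definition state_play (b b' : bool) (i : nat) : states delay_game :=
  state (play k b b' i).

Lemma number_state_play b b' i : number (state_play b b' i) = play k b b' i.
Proof. by rewrite stateK // /play; lia. Qed.

Lemma state_play_init b b' t :
  starts_in_init (Fin (mkseq (state_play b b') t.+1)).
Proof. by []. Qed.

Lemma state_play_step b b' i a : (i = k -> a = b') ->
  state_play b b' i.+1 \in trans (state_play b b' i) a.
Proof. by move=> eq_a; rewrite inE !number_state_play play_edge //; lia. Qed.

Lemma no_short_memory_winning (xi : strategy delay_game) :
  history_dependent (k - 1) xi -> winning xi -> False.
Proof.
move=> hist_xi [xi_neq0 xi_wins].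
(* Away from index [k] the choice of action is irrelevant, so nonemptiness of [xi] is enough. *)
have xi_step b b' t : t <> k ->
    consistent xi (Fin (mkseq (state_play b b') t.+1)) ->
    exists2 a, a \in xi (mkseq (state_play b b') t.+1) &
      state_play b b' t.+1 \in trans (state_play b b' t) a.
  move=> ne_tk con_t.
  have /set0Pn[a xi_a] := xi_neq0 _ (state_play_init _ _ _) con_t.
  by exists a => //; apply: state_play_step.
have con_k : consistent xi (Fin (mkseq (state_play false false) k.+1)).
  by apply: consistent_mkseq => t lt_tk; apply: xi_step; lia.
have /set0Pn[a xi_a] := xi_neq0 _ (state_play_init _ _ _) con_k.
(* [a] is an answer of [xi] after the bit [false]; [w] keeps this answer but lets the environment
   choose the bit that makes it wrong. *)
pose w := state_play (~~ a) a.
have {}xi_a : a \in xi (mkseq w k.+1).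
  (* The last [k - 1] of [k.+1] letters begin at index 2, just after [x_b], where both plays
     coincide. *)
  rewrite (hist_xi _ (mkseq (state_play false false) k.+1)) //.
  rewrite /last_entries !size_mkseq /mkseq -!map_drop drop_iota.
  apply/eq_in_map => i; rewrite mem_iota => hi.
  by congr state; rewrite /play; lia.
have w_step t : consistent xi (Fin (mkseq w t.+1)) ->
    exists2 a', a' \in xi (mkseq w t.+1) & w t.+1 \in trans (w t) a'.
  have [->|/eqP ne_tk] := eqVneq t k; last exact: xi_step.
  by exists a => //; apply: state_play_step.
have con_w : consistent xi (Inf w).
  apply/consistent_infP => t; apply/w_step/consistent_mkseq => j _.
  exact: w_step.
have path_w : is_path (Inf w).
  move=> [//|t] s s' [<-] [<-].
  by have [a' _ step_a'] := (consistent_infP xi w).1 con_w t; exists a'.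
have := xi_wins _ path_w erefl con_w.
move/(models_phi _ (path_is_play _ path_w erefl)).
by rewrite !number_state_play /play; lia.
Qed.

End Game.

Theorem theorem2 (R : realType) (d : nat) (hd : (1 <= d)%N)
    (dtau : R) (hdtau : 0 < dtau) (k : nat) (hk : (2 <= k)%N) :
  exists (phi : formula R d) (G : game dtau phi),
    ord phi = k /\
    (exists xi : strategy G, history_dependent k xi /\ winning xi) /\
    ~ (exists xi : strategy G, history_dependent (k - 1)%N xi /\ winning xi).
Proof.
exists (phi dtau k), (delay_game hd dtau k); split; first exact: ord_phi.
split=> [|[xi [hist_xi win_xi]]]; last exact: no_short_memory_winning win_xi.
exists (recall hd dtau k); split; last exact: winning_recall.
by move=> w w' eq_w; rewrite /recall eq_w.
Qed.
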